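(* Let $G$ be a finite group and suppose that its commuting graph $\Gamma(G)$ has an isolated vertex. Then $\Gamma(G)$ has exactly $|G|/2$ isolated vertices and the remaining vertices form a clique.
   Context: For a group $G$ with centre $Z(G)$, the commuting graph $\Gamma(G)$ is the simple graph with vertex set $G\setminus Z(G)$ in which two distinct vertices $x,y$ are adjacent if and only if $xy=yx$. A vertex is isolated if it has no neighbours. A set of vertices forms a clique if any two distinct vertices in it are adjacent. *)

(* Defs.v *)
From HB Require Import structures.
From mathcomp Require Import all_boot all_fingroup.
From mathcomp Require Import center.

Set Implicit Arguments.
Unset Strict Implicit.
Unset Printing Implicit Defensive.

Import GroupScope.

Record sgraph := SGraph {
  vertex :> finType;
  adj : rel vertex;
  adj_sym : symmetric adj;
  adj_irrefl : irreflexive adj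
}.

Definition isolated_vertices (X : sgraph) : {set X} :=
  [set x : X | [forall y : X, ~~ adj x y]].

Definition is_clique (X : sgraph) (S : {set X}) : Prop :=
  forall x y : X, x \in S -> y \in S -> x != y -> adj x y.

Section CommutingGraph.

Variables (gT : finGroupType) (G : {group gT}).

Definition noncentral : finType := {x : gT | x \in G :\: 'Z(G)}.

Definition commuting_adj : rel noncentral :=
  [rel x y | (x != y) && ((val x * val y)%g == (val y * val x)%g)].

Fact commuting_adj_sym : symmetric commuting_adj.
Proof. by move=> x y; rewrite /commuting_adj /= eq_sym [X in _ && X]eq_sym. Qed.

Fact commuting_adj_irrefl : irreflexive commuting_adj.
Proof. by move=> x; rewrite /commuting_adj /= eqxx. Qed.

Definition commuting_graph : sgraph :=
  SGraph commuting_adj_sym commuting_adj_irrefl.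

End CommutingGraph.

(* Main.v *)
(** Let [x] be isolated. If [z] is central and nontrivial, then [x z] is a
    second vertex commuting with [x]; so the centre is trivial and the
    centralizer of [x] is [{1, x}], whence [x] is an involution whose class [K]
    has [|G|/2] elements. No product [x k] with [k] in [K] lies in [K] (else [x]
    and [k] commute and [k = x]), so by counting [x K] is the complement of [K].
    The involution [x] inverts [x k], so every element of [K] inverts every
    element outside [K]. An element outside [K] is therefore a product of two
    elements that both invert the complement of [K], so it centralizes it. It is
    not isolated unless trivial: otherwise it would be an involution, inverted
    and hence centralized by [x], but only [1] and [x] commute with [x]. *)
Require Import Defs.
From HB Require Import structures.
From mathcomp Require Import all_boot all_fingroup.
From mathcomp Require Import center.

Set Implicit Arguments.
Unset Strict Implicit.
Unset Printing Implicit Defensive.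

Import GroupScope.

Section SelfCentralizing.

Variables (gT : finGroupType) (G : {group gT}).

Lemma cent1_pair_sqr (x : gT) :
  x \in G -> 'C_G[x] = [set 1; x] -> x * x = 1.
Proof.
move=> Gx Cx; have : x^-1 \in 'C_G[x] by rewrite inE groupV Gx groupV cent1id.
rewrite Cx !inE => /orP[]/eqP.
  by move/(canRL invgK); rewrite invg1 => ->; rewrite mulg1.
by move=> {1}<-; rewrite mulVg.
Qed.

Lemma cent1_pair_conjg (x g : gT) :
  g \in G -> 'C_G[x] = [set 1; x] -> 'C_G[x ^ g] = [set 1; x ^ g].
Proof.
move=> Gg Cx; rewrite -{1}(conjGid Gg) cent1J -conjIg Cx.
by rewrite /conjugate imsetU !imset_set1 conj1g.
Qed.

Variable x : gT.
Hypotheses (Gx : x \in G) (ntx : x != 1) (Cx : 'C_G[x] = [set 1; x]).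

Lemma card_class_cent1_pair : (2 * #|x ^: G| = #|G|)%N.
Proof.
have := Lagrange (subsetIl G 'C[x]); rewrite index_cent1 => <-.
by rewrite /= Cx cards2 eq_sym ntx.
Qed.

Lemma class_mem_cent1_pair (y : gT) : y \in x ^: G ->
  [/\ y \in G, y != 1, 'C_G[y] = [set 1; y] & y * y = 1].
Proof.
case/imsetP=> g Gg ->; have Cy := cent1_pair_conjg Gg Cx.
by split; rewrite ?groupJ ?conjg_eq1 ?(cent1_pair_sqr _ Cy) ?groupJ.
Qed.

Lemma lcoset_class_cent1_pair : x *: (x ^: G) = G :\: x ^: G.
Proof.
(* Both sides have [#|G| / 2] elements, so one inclusion suffices. *)
apply/eqP; rewrite eqEcard; apply/andP; split; last first.
  rewrite card_lcoset cardsD (setIidPr _) ?class_subG // -card_class_cent1_pair.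
  by rewrite mul2n -addnn addnK.
apply/subsetP=> _ /lcosetP[k Kk ->].
have [Gk ntk _ kk1] := class_mem_cent1_pair Kk.
rewrite inE groupM // andbT; apply/negP => Kxk.
have [_ ntxk _ xkxk1] := class_mem_cent1_pair Kxk.
have xx1 := cent1_pair_sqr Gx Cx.
have xI : x^-1 = x by apply/eqP; rewrite eq_invg_mul xx1.
have kI : k^-1 = k by apply/eqP; rewrite eq_invg_mul kk1.
(* [x], [k] and [x * k] are all their own inverses, so inverting [x * k] gives [k * x = x * k]. *)
have : k \in 'C_G[x].
  rewrite inE Gk; apply/cent1P; rewrite /commute.
  have /eqP := xkxk1; rewrite -eq_invg_mul invMg kI xI => /eqP.
  by move->.
(* This leaves [k = x], so [x * k = 1], which is no conjugate of [x]. *)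
rewrite Cx !inE (negPf ntk) /= => /eqP kx.
by rewrite kx xx1 eqxx in ntxk.
Qed.

Lemma conjg_notin_class (n : gT) : n \in G :\: x ^: G -> n ^ x = n^-1.
Proof.
rewrite -lcoset_class_cent1_pair => /lcosetP[k Kk ->].
have [_ _ _ kk1] := class_mem_cent1_pair Kk.
have xI : x^-1 = x.
  by apply/eqP; rewrite eq_invg_mul (cent1_pair_sqr Gx Cx).
have kI : k^-1 = k by apply/eqP; rewrite eq_invg_mul kk1.
by rewrite /conjg invMg kI xI !mulgA -{1}xI mulVg mul1g.
Qed.

End SelfCentralizing.

(** Each [k] in the class satisfies the same hypotheses as [x]. With [m = x * k], conjugation by [x]
    and then by [k] inverts [n] twice. *)
Lemma commute_notin_class (gT : finGroupType) (G : {group gT}) (x m n : gT) :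
  x \in G -> x != 1 -> 'C_G[x] = [set 1; x] ->
  m \in G :\: x ^: G -> n \in G :\: x ^: G -> commute m n.
Proof.
move=> Gx ntx Cx Nm Nn.
move: Nm; rewrite -lcoset_class_cent1_pair // => /lcosetP[k Kk ->].
have [Gk ntk Ck _] := class_mem_cent1_pair Gx ntx Cx Kk.
apply: commute_sym; apply/commgP/conjg_fixP.
rewrite conjgM (conjg_notin_class Gx ntx Cx Nn) conjVg.
by rewrite (conjg_notin_class Gk ntk Ck) ?invgK // (class_eqP Kk).
Qed.

(** Passes from the graph to the group; as [val v] is noncentral, the centralizer condition also
    forces a trivial centre. *)
Lemma isolated_verticesP (gT : finGroupType) (G : {group gT})
    (v : commuting_graph G) :
  reflect ('C_G[val v] = [set 1; val v])
          (v \in isolated_vertices (commuting_graph G)).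
Proof.
have /setDP[Gv nZv] := valP v.
rewrite inE; apply: (iffP forallP) => [iso_v | Cv w].
  have CvZ y : y \in 'C_G[val v] -> y != val v -> y \in 'Z(G).
    case/setIP=> Gy /cent1P cyv nyv; apply/idPn => nZy.
    have NCy : y \in G :\: 'Z(G) by rewrite inE nZy.
    have /negP[] := iso_v (Sub y NCy).
    apply/andP; split; last exact/eqP.
    by apply: contraNneq nyv => ->; rewrite SubK.
  apply/setP => y; rewrite in_set2; apply/idP/orP => [Cy|]; last first.
    by case=> /eqP->; rewrite ?group1 // in_setI Gv cent1id.
  have [->|nyv] := eqVneq y (val v); [by right | left].
  (* If [y] is nontrivial, then [y] and [val v * y] both commute with [val v] and differ from it, so
     both are central, and hence so is [val v]. *)
  apply: contraR nZv => nty; have Zy := CvZ y Cy nyv.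
  rewrite -(groupMr _ Zy) CvZ //; first by rewrite groupM // in_setI Gv cent1id.
  by apply: contra_neq nty => vyv; apply: (mulgI (val v)); rewrite vyv mulg1.
apply/negP => /andP[nvw /eqP cvw]; have /setDP[Gw nZw] := valP w.
have : val w \in 'C_G[val v] by rewrite inE Gw; apply/cent1P.
rewrite Cv !inE [_ == val v]eq_sym val_eqE (negPf nvw) orbF => /eqP w1.
by rewrite w1 group1 in nZw.
Qed.

Lemma isolated_vertices_class (gT : finGroupType) (G : {group gT})
    (v w : commuting_graph G) :
  v \in isolated_vertices (commuting_graph G) ->
  (w \in isolated_vertices (commuting_graph G)) = (val w \in val v ^: G).
Proof.
move=> /isolated_verticesP Cv.
have /setDP[Gv nZv] := valP v; have /setDP[Gw nZw] := valP w.
have ntv : val v != 1 by apply: contraNneq nZv => ->; apply: group1.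
have ntw : val w != 1 by apply: contraNneq nZw => ->; apply: group1.
apply/isolated_verticesP/idP => [Cw | /(class_mem_cent1_pair Gv ntv Cv)[] //].
apply/idPn => nKw; have Nw : val w \in G :\: val v ^: G by rewrite inE nKw.
have wI : (val w)^-1 = val w.
  by apply/eqP; rewrite eq_invg_mul (cent1_pair_sqr Gw Cw).
(* Since [val w] is its own inverse, being inverted by [val v] means commuting with it. *)
have : val w \in 'C_G[val v].
  rewrite inE Gw cent1C; apply/cent1P/commute_sym/commgP/conjg_fixP.
  by rewrite (conjg_notin_class Gv ntv Cv Nw).
rewrite Cv !inE (negPf ntw) /= => /eqP wv.
by case/negP: nKw; rewrite [val w]wv class_refl.
Qed.

Theorem theorem1p2 (gT : finGroupType) (G : {group gT}) :
  (exists x : commuting_graph G, x \in isolated_vertices (commuting_graph G)) ->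
  (2 * #|isolated_vertices (commuting_graph G)| = #|G|)%N /\
  is_clique (~: isolated_vertices (commuting_graph G)).
Proof.
case=> v iso_v; have /isolated_verticesP Cv := iso_v.
have /setDP[Gv nZv] := valP v.
have ntv : val v != 1 by apply: contraNneq nZv => ->; apply: group1.
split=> [|w u]; last first.
  rewrite !in_setC !(isolated_vertices_class _ iso_v) => nKw nKu nwu.
  have /setDP[Gw _] := valP w; have /setDP[Gu _] := valP u.
  rewrite /= /commuting_adj /= nwu; apply/eqP.
  by apply: (commute_notin_class Gv ntv Cv); rewrite inE ?nKw ?nKu.
rewrite -(card_class_cent1_pair ntv Cv) -(card_imset _ val_inj).
congr (2 * #|pred_of_set _|)%N; apply/setP => y.
apply/imsetP/idP => [[w iso_w ->] | Ky].
  by rewrite -(isolated_vertices_class _ iso_v).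
(* Conjugates of [val v] are again vertices because the centre is normal. *)
have NCy : y \in G :\: 'Z(G).
  case/imsetP: Ky => g Gg ->.
  rewrite in_setD memJ_norm ?nZv ?groupJ //.
  exact: subsetP (normal_norm (center_normal G)) g Gg.
by exists (Sub y NCy); rewrite ?(isolated_vertices_class _ iso_v).
Qed.
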